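(* Let $(X,\mathcal B,\mu)$ be a $\sigma$-finite measure space with $\mu(X)>0$, let $\mathcal X\subset L^0(\mu)$ be an admissible Banach space of functions defined on $X$, and let $f:X\to X$ be a measurable nonsingular map such that the composition operator $T_f:\varphi\mapsto\varphi\circ f$ is bounded on $\mathcal X$. Then the following assertions are equivalent: (B1) $T_f$ is topologically mixing; (B2) $f^{-1}(\mathcal B)=\mathcal B$ and, for all $\epsilon>0$ and all $A\in\mathcal B$ with finite measure, there exist $k_0\ge 1$ and two sequences $(B_k)$, $(C_k)$ of measurable subsets of $X$ such that, for all $k\ge k_0$, $$\mu(A\setminus B_k)<\epsilon,\quad \mu(f^{-k}(B_k))<\epsilon,\quad f^k(B_k)\subset C_k\quad\text{and}\quad \mu(C_k)<\epsilon.$$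
   Context: $L^0(\mu)$ denotes the space of measurable scalar-valued functions on $X$ (up to $\mu$-a.e. equality). A Banach space of functions $(\mathcal X,\|\cdot\|)\subset L^0(\mu)$ is always assumed to be a lattice: if $\psi_1,\psi_2$ are measurable functions with $|\psi_1|\le|\psi_2|$ and $\psi_2\in\mathcal X$, then $\psi_1\in\mathcal X$ and $\|\psi_1\|\le\|\psi_2\|$. It is called admissible if: (H1) for every $A\in\mathcal B$ with finite measure, the characteristic function $\chi_A$ belongs to $\mathcal X$; (H2) the set of simple functions which vanish outside a set of finite measure is dense in $\mathcal X$; (H3) for all $\epsilon>0$ there exists $\delta>0$ such that, for all $\psi\in\mathcal X$ and all $S\in\mathcal B$, $|\psi|\ge 1$ on $S$ and $\|\psi\|\le\delta$ imply $\mu(S)<\epsilon/2$; (H4) for all $\eta>0$ and all $M>0$ there exists $\epsilon>0$ such that, for all $\psi\in\mathcal X$ and all $S\in\mathcal B$, $\mu(S)<\epsilon$, $\psi=0$ on $X\setminus S$ and $|\psi|\le 2M$ imply $\|\psi\|<\eta/2$. A measurable map $f:X\to X$ is nonsingular if $\mu(f^{-1}(S))=0$ whenever $\mu(S)=0$. Here $f^{-1}(\mathcal B)=\{f^{-1}(S):S\in\mathcal B\}$, $f^k$ is the $k$-th iterate of $f$, and $f^{-k}(S)$ is the preimage of a set $S$ under $f^k$. A bounded linear operator $T$ on a Banach space $\mathcal X$ is topologically mixing if for any nonempty open sets $U,V\subset\mathcal X$ there exists an integer $k_0\ge0$ such that $T^k(U)\cap V\ne\emptyset$ for every $k\ge 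k_0$.
   Formalization: In (B2) the equality f^{-1}(B)=B is taken modulo μ-null sets; with literal equality (B1)⇒(B2) fails, e.g. for the shift on Z with weights 2^{-|n|} and two added null points a, b with f(a)=f(b)=a. *)

(* Defs.v *)
From HB Require Import structures.
From mathcomp Require Import all_boot all_order all_algebra.
From mathcomp Require Import all_classical all_reals all_analysis.
From mathcomp Require Import complex.

Set Implicit Arguments.
Unset Strict Implicit.
Unset Printing Implicit Defensive.

Import Order.TTheory GRing.Theory Num.Theory.
Import numFieldNormedType.Exports.

Local Open Scope classical_set_scope.
Local Open Scope ring_scope.

(* Function spaces may be real or complex. In the complex case norms take
   their values in [complex R], and [0 < a] in [complex R] says that [a] is
   real and positive, so the norm inequalities below are real ones. *)
Variant scalar_kind := RealScalars | ComplexScalars.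

Definition scalars (R : realType) (s : scalar_kind) : numFieldType :=
  match s with
  | RealScalars => R
  | ComplexScalars => complex R
  end.

Definition borel (K : numFieldType) := g_sigma_algebraType (@open K).

(* [{mfun_ mu, X >-> borel K}] is L^0(mu): K-valued Borel measurable functions
   on X, quotiented by equality mu-a.e. *)
Record banach_function_space (R : realType) (d : measure_display)
    (X : measurableType d) (mu : {measure set X -> \bar R})
    (K : numFieldType) := BanachFunctionSpace {
  bfs_space :> completeNormedModType K;
  bfs_class : bfs_space -> {mfun_ mu, X >-> borel K};
  bfs_class_inj : injective bfs_class;
  bfs_class_linear : forall (a : K) (u v : bfs_space),
    (bfs_class (a *: u + v) : X -> K)
      = (fun x => a * (bfs_class u x : K) + (bfs_class v x : K)) %[ae mu];
  bfs_lattice : forall (psi : {mfun_ mu, X >-> borel K}) (v : bfs_space),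
    {ae mu, forall x, `|psi x : K| <= `|bfs_class v x : K|} ->
    exists u : bfs_space, bfs_class u = psi /\ `|u| <= `|v|
}.

(* A representative of [u], so only meaningful up to a mu-null set. *)
Definition fun_of (R : realType) (d : measure_display)
    (X : measurableType d) (mu : {measure set X -> \bar R})
    (K : numFieldType) (E : banach_function_space mu K) (u : E) : X -> K :=
  bfs_class u.

Section Admissible.
Context (R : realType) (d : measure_display) (X : measurableType d)
  (mu : {measure set X -> \bar R}) (K : numFieldType)
  (E : banach_function_space mu K).

Definition contains_indicators :=
  forall A : set X, measurable A -> (mu A < +oo)%E ->
  exists u : E, fun_of u = \1_A %[ae mu].

Definition simple_finite_support (s : X -> K) :=
  [/\ measurable_fun setT (s : X -> borel K), finite_set (range s) &
      exists A : set X, [/\ measurable A, (mu A < +oo)%E &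
                            forall x, ~ A x -> s x = 0]].

Definition simple_functions_dense :=
  dense [set u : E | exists s : X -> K,
           simple_finite_support s /\ fun_of u = s %[ae mu]].

Definition small_norm_small_support :=
  forall eps : R, 0 < eps -> exists delta : K, 0 < delta /\
  forall (u : E) (S : set X), measurable S ->
    {ae mu, forall x, S x -> 1 <= `|fun_of u x|} ->
    `|u| <= delta -> (mu S < (eps / 2)%:E)%E.

Definition small_support_small_norm :=
  forall eta M : K, 0 < eta -> 0 < M -> exists eps : R, 0 < eps /\
  forall (u : E) (S : set X), measurable S -> (mu S < eps%:E)%E ->
    {ae mu, forall x, ~ S x -> fun_of u x = 0} ->
    {ae mu, forall x, `|fun_of u x| <= 2 * M} ->
    `|u| < eta / 2.

Definition admissible :=
  [/\ contains_indicators, simple_functions_dense,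
      small_norm_small_support & small_support_small_norm].

Definition is_composition_operator (f : X -> X) (T : E -> E) :=
  forall u : E, fun_of (T u) = fun_of u \o f %[ae mu].

End Admissible.

Definition bounded_operator (K : numFieldType) (E : normedModType K)
    (T : E -> E) :=
  exists M : K, forall u : E, `|T u| <= M * `|u|.

Definition topologically_mixing (E : topologicalType) (T : E -> E) :=
  forall U V : set E, open U -> open V -> U !=set0 -> V !=set0 ->
  exists k0 : nat, forall k : nat, (k0 <= k)%N ->
    (iter k T @` U) `&` V !=set0.

Definition nonsingular (R : realType) (d : measure_display)
    (X : measurableType d) (mu : {measure set X -> \bar R}) (f : X -> X) :=
  forall S : set X, measurable S -> mu S = 0%E -> mu (f @^-1` S) = 0%E.

(* Equality of two families of measurable sets modulo mu-null sets. For
   [f^-1(B) = B] this is the only sensible reading: composition operators on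
   L^0(mu) do not see null sets, while the set-theoretic equality can be
   destroyed by adjoining two null points a, b to X with f a = f b = a. *)
Definition eq_mod_null (R : realType) (d : measure_display)
    (X : measurableType d) (mu : {measure set X -> \bar R})
    (F G : set (set X)) :=
  (forall A, F A -> exists B, G B /\ mu (A `+` B) = 0%E) /\
  (forall B, G B -> exists A, F A /\ mu (A `+` B) = 0%E).

(* Main.v *)
(** Mixing implies (B2): apply mixing to the two pairs of balls around 0 and
    around [a], twice the indicator of A.  If [u] is close to [a] and [T^k u]
    is small, and if [v] is small and [T^k v] is close to [a],
    then by (H3) the sets [B_k = {1 <= |u|} /\ f^-k {1 <= |v|}] and
    [C_k = {1 <= |v|}] work.  Density of the range of [T] yields sets S with
    [mu (A `+` f^-1 S)] arbitrarily small, and Borel-Cantelli makes it zero.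

    (B2) implies mixing: given simple functions [s] and [t], write [t] as
    [g o f^k] almost everywhere; by (H4), [s 1_(B_k) + g 1_(C_k)] is close to
    [s], and its image under [T^k] is close to [t]. *)

Require Import Defs.
From HB Require Import structures.
From mathcomp Require Import all_boot all_order all_algebra.
From mathcomp Require Import all_classical all_reals all_analysis.

Import Order.TTheory GRing.Theory Num.Theory.
Import numFieldNormedType.Exports.

Set Implicit Arguments.
Unset Strict Implicit.
Unset Printing Implicit Defensive.

Local Open Scope classical_set_scope.
Local Open Scope ring_scope.

(** * Nonsingular maps and preimages modulo null sets *)

Section NonsingularMaps.
Context (R : realType) (d : measure_display) (X : measurableType d)
  (mu : {measure set X -> \bar R}).
Implicit Types (f : X -> X) (A S : set X).

Lemma measurable_preimage f S :
  measurable_fun setT f -> measurable S -> measurable (f @^-1` S).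
Proof. by move=> mf mS; rewrite -[_ @^-1` _]setTI; exact: mf. Qed.

Lemma measurable_iter f k :
  measurable_fun setT f -> measurable_fun setT (iter k f).
Proof.
move=> mf; elim: k => [|k IHk]; first exact: measurable_id.
exact: (measurableT_comp mf IHk).
Qed.

Lemma nonsingular_iter f k :
  measurable_fun setT f -> nonsingular mu f -> nonsingular mu (iter k f).
Proof.
move=> mf nsf; elim: k => [|k IHk] S mS S0 //.
by apply: (IHk (f @^-1` S)); [exact: measurable_preimage|exact: nsf].
Qed.

(** Nonsingularity keeps the pulled-back exceptional set null. *)
Lemma ae_comp f (P : X -> Prop) :
  measurable_fun setT f -> nonsingular mu f ->
  (\forall x \ae mu, P x) -> \forall x \ae mu, P (f x).
Proof.
move=> mf nsf [N [mN N0 PN]]; exists (f @^-1` N); split.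
- exact: measurable_preimage.
- exact: nsf.
- by move=> x /= Px; exact: PN.
Qed.

Lemma measurable_setY A S : measurable A -> measurable S -> measurable (A `+` S).
Proof. by move=> mA mS; apply: measurableU; exact: measurableD. Qed.

Lemma measure_setY0 A S : measurable A -> measurable S ->
  mu (A `+` S) = 0%E <-> \forall x \ae mu, A x <-> S x.
Proof.
move=> mA mS; rewrite -negligibleP; last exact: measurable_setY.
suff -> : A `+` S = ~` [set x | A x <-> S x] by [].
apply/seteqP; split => x /=.
  by move=> [[Ax nSx]|[Sx nAx]] AS; [exact/nSx/AS|exact/nAx/AS].
have [Ax|nAx] := pselect (A x); have [Sx|nSx] := pselect (S x); tauto.
Qed.

(** The a.e. form of [A] being a preimage under [f], kept pointwise so that such facts combine by
    filter reasoning. *)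
Definition ae_preimage f A :=
  exists2 S, measurable S & \forall x \ae mu, A x <-> S (f x).

(** In the inductive step, the equivalence between [S] and its own preimage form is pulled back
    along [iter k f]. *)
Lemma ae_preimage_iter f k A : measurable_fun setT f -> nonsingular mu f ->
  (forall A', measurable A' -> ae_preimage f A') -> measurable A ->
  ae_preimage (iter k f) A.
Proof.
move=> mf nsf fB mA; elim: k => [|k [S mS AS]].
  by exists A => //; exact: aeW.
have [S' mS' SS'] := fB _ mS; exists S' => //.
have := ae_comp (measurable_iter k mf) (nonsingular_iter k mf nsf) SS'.
by apply: filterS2 AS => x -> ->.
Qed.

Lemma ae_preimage_bigcup f (F : nat -> set X) :
  (forall n, ae_preimage f (F n)) -> ae_preimage f (\bigcup_n F n).
Proof.
move=> /(_ _)/cid2 hF; exists (\bigcup_n projT1 (hF n)).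
  by apply: bigcupT_measurable => n; case: (hF n).
have /ae_foralln : forall n, \forall x \ae mu, F n x <-> projT1 (hF n) (f x).
  by move=> n; case: (hF n).
by apply: filterS => x FS; split=> -[n _ Fn]; exists n => //; exact/FS.
Qed.

(** Mixing controls only sets of finite measure; a countable exhaustion lifts that restriction. *)
Lemma ae_preimage_sigma_finite f A : sigma_finite setT mu ->
  (forall A', measurable A' -> (mu A' < +oo)%E -> ae_preimage f A') ->
  measurable A -> ae_preimage f A.
Proof.
move=> [F FT mF] fB mA; rewrite -[A]setTI FT setI_bigcupl.
apply: ae_preimage_bigcup => n; have [mFn Fnoo] := mF n.
have mFA : measurable (F n `&` A) by exact: measurableI.
apply: fB => //; apply: le_lt_trans Fnoo.
by rewrite le_measure ?inE//; exact: subIsetl.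
Qed.

(** Borel-Cantelli: with summable errors, almost every point lies in finitely many of the symmetric
    differences, so [lim_sup_set S] pulls back to [A]. *)
Lemma ae_preimage_approx f A : measurable_fun setT f -> measurable A ->
  (forall eps : R, 0 < eps ->
    exists2 S, measurable S & (mu (A `+` f @^-1` S) < eps%:E)%E) ->
  ae_preimage f A.
Proof.
move=> mf mA fA.
have e0 n : 0 < 1 / (2 ^ n.+1)%:R :> R by rewrite divr_gt0// ltr0n expn_gt0.
pose S n := projT1 (cid2 (fA _ (e0 n))).
have mS n : measurable (S n) by rewrite /S; case: cid2.
have fS n : (mu (A `+` f @^-1` S n) < (1 / (2 ^ n.+1)%:R)%:E)%E.
  by rewrite /S; case: cid2.
have mlS : measurable (lim_sup_set S).
  by apply: bigcapT_measurable => n; exact: bigcup_measurable.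
exists (lim_sup_set S) => //.
exists (lim_sup_set (fun n => A `+` f @^-1` S n)); split.
- apply: bigcapT_measurable => n; apply: bigcup_measurable => k _.
  by apply: measurable_setY => //; exact: measurable_preimage.
- apply: lim_sup_set_cvg0.
    by move=> n; apply: measurable_setY => //; exact: measurable_preimage.
  apply: (@le_lt_trans _ _ 1%E); last exact: ltry.
  apply: le_trans (epsilon_trick0 xpredT ler01).
  by apply: lee_nneseries => // n _; exact: ltW.
(* A point where the equivalence fails is in infinitely many differences: for [x] in [A], the sets
   [S k] miss [f x] from some [m] on, so [maxn n m] serves; otherwise any [m] past [n] with [f x] in
   [S m] does. *)
- move=> x /= AS n _; have [Ax|nAx] := pselect (A x).
    apply: contrapT => nS; apply: AS; split=> // _ m _.
    have := nS; apply: contra_notP => nSm.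
    exists (maxn n m); first by rewrite /= leq_maxl.
    left; split=> // Snm; apply: nSm; exists (maxn n m) => //=.
    exact: leq_maxr.
  apply: contrapT => nS; apply: AS; split=> // Sx; exfalso; apply: nS.
  by have [m nm Sm] := Sx n I; exists m => //; right.
Qed.

(** * Scalar-valued measurable functions *)

Context (K : numFieldType).

Lemma measurable_set1 (c : K) : measurable ([set c] : set (borel K)).
Proof.
rewrite -[X in measurable X]setCK; apply: measurableC.
apply: sub_sigma_algebra; apply: closed_openC.
apply: accessible_closed_set1; apply: hausdorff_accessible.
exact: (@norm_hausdorff K K^o).
Qed.

(** The complement of an open ball is used because [borel K] is generated by open sets; the order of
    [K] may be partial, but norms are comparable with 1. *)
Lemma measurable_norm_ge1 (g : X -> K) :
  measurable_fun setT (g : X -> borel K) -> measurable [set x | 1 <= `|g x|].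
Proof.
move=> mg.
have -> : [set x | 1 <= `|g x|] = g @^-1` (~` ball (0 : K) 1).
  apply/seteqP; split=> x; rewrite /ball /= sub0r normrN.
    by rewrite real_leNgt ?real1 ?normr_real// => /negP.
  by move=> /negP; rewrite -real_leNgt ?real1 ?normr_real.
rewrite -[_ @^-1` _]setTI; apply: mg => //; apply: measurableC.
by apply: sub_sigma_algebra; exact: (@ball_open K K^o).
Qed.

Lemma measurable_glue A (g h : X -> K) : measurable A ->
  measurable_fun setT (g : X -> borel K) ->
  measurable_fun setT (h : X -> borel K) ->
  measurable_fun setT ((fun x => if x \in A then g x else h x) : X -> borel K).
Proof.
move=> mA mg mh; apply: measurable_fun_ifT => //.
by apply: (measurable_fun_bool true); rewrite setTI preimage_mem_true.
Qed.

(** Induction on the list of values: the level set of [c] is almost everywhere a preimage of some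
    [S], so [g] may take the value [c] on [S]. *)
Lemma finite_range_factor f (psi : X -> K) (M : K) :
  (forall A, measurable A -> ae_preimage f A) -> 0 <= M ->
  measurable_fun setT (psi : X -> borel K) -> finite_set (range psi) ->
  (forall x, `|psi x| <= M) ->
  exists g : X -> K, [/\ measurable_fun setT (g : X -> borel K),
    forall x, `|g x| <= M & \forall x \ae mu, psi x = g (f x)].
Proof.
move=> fB M0 mpsi /finite_seqP[l rl] psiM.
(* The value 0 is added because the induction overwrites the head value by 0. *)
have : forall x, psi x \in 0 :: l.
  move=> x; rewrite inE; apply/orP; right.
  by have : [set` l] (psi x) by rewrite -rl; exists x.
elim: l {rl} psi mpsi psiM => [|c l IHl] psi mpsi psiM psil.
  exists (cst 0); split; [exact: measurable_cst|by move=> x; rewrite normr0|].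
  by apply: aeW => x; have := psil x; rewrite inE => /eqP.
(* A listed value violating the bound is never attained and is dropped, so that [g] is bounded
   everywhere. *)
have [cM|ncM] := pselect (`|c| <= M); last first.
  apply: IHl => // x; have := psil x; rewrite !inE => /or3P[->//|/eqP xc|->].
    by case: ncM; rewrite -xc.
  by rewrite orbT.
pose A := psi @^-1` [set c].
have mA : measurable A.
  by rewrite /A -[_ @^-1` _]setTI; apply: mpsi => //; exact: measurable_set1.
have [||x|g [mg gM psig]] := IHl (fun x => if x \in A then 0 else psi x).
- by apply: measurable_glue => //; exact: measurable_cst.
- by move=> x; case: ifP; rewrite ?normr0.
- case: ifPn => [_|]; first by rewrite inE eqxx.
  rewrite notin_setE => xc; have := psil x; rewrite !inE => /or3P[->//|/eqP//|->].
  by rewrite orbT.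
have [S mS AS] := fB A mA.
exists (fun x => if x \in S then c else g x); split.
- by apply: measurable_glue => //; exact: measurable_cst.
- by move=> x; case: ifP.
apply: filterS2 AS psig => x AS <-; case: ifPn.
  by rewrite inE => /AS.
by rewrite notin_setE => nS; case: ifPn => //; rewrite inE => /AS.
Qed.

(** A sum avoids maxima in a possibly partial order; the extra 1 gives the positivity that (H4) asks
    for. *)
Lemma finite_range_bounded (psi : X -> K) : finite_set (range psi) ->
  exists2 M : K, 0 < M & forall x, `|psi x| <= M.
Proof.
move=> /finite_seqP[l rl]; exists (1 + \sum_(c <- l) `|c|).
  by rewrite ltr_wpDr// sumr_ge0.
move=> x; have : [set` l] (psi x) by rewrite -rl; exists x.
by move=> /= xl; rewrite (big_rem _ xl)/= addrCA lerDl addr_ge0// sumr_ge0.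
Qed.

End NonsingularMaps.

(** * Representatives of elements of the function space *)

Section FunctionSpace.
Context (R : realType) (d : measure_display) (X : measurableType d)
  (mu : {measure set X -> \bar R}) (K : numFieldType)
  (E : banach_function_space mu K).
Implicit Types (u v : E) (A S : set X).

Lemma measurable_fun_of u : measurable_fun setT (fun_of u : X -> borel K).
Proof. exact: measurable_funPT. Qed.

Lemma fun_of0 : \forall x \ae mu, fun_of (0 : E) x = 0.
Proof.
have := bfs_class_linear (1 : K) (0 : E) 0.
rewrite scaler0 addr0; apply: filterS => x /(_ I).
by rewrite mul1r => /eqP; rewrite eq_sym -subr_eq0 addrK => /eqP.
Qed.

Lemma fun_ofZ (a : K) u : \forall x \ae mu, fun_of (a *: u) x = a * fun_of u x.
Proof.
have := bfs_class_linear a u 0; rewrite addr0.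
apply: filterS2 fun_of0 => x u0 /(_ I); rewrite /fun_of => ->.
by rewrite [X in _ + X]u0 addr0.
Qed.

Lemma fun_ofB u v :
  \forall x \ae mu, fun_of (u - v) x = fun_of u x - fun_of v x.
Proof.
have := bfs_class_linear (-1 : K) v u; rewrite scaleN1r addrC.
by apply: filterS => x /(_ I); rewrite /fun_of => ->; rewrite mulN1r addrC.
Qed.

(** The lattice axiom speaks of classes, so it is applied to the class of [g], whose representative
    agrees with [g] a.e. *)
Lemma exists_fun_of (g : X -> K) v : measurable_fun setT (g : X -> borel K) ->
  (\forall x \ae mu, `|g x| <= `|fun_of v x|) ->
  exists u, \forall x \ae mu, fun_of u x = g x.
Proof.
move=> mg gv; pose g' : {mfun X >-> borel K} := mfun_Sub (mem_set mg).
pose q : {mfun_ mu, X >-> borel K} := \pi_({mfun_ mu, X >-> borel K})%qT g'.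
have qg : \forall x \ae mu, (q x : K) = g x.
  have : (repr q == g' %[mod {mfun_ mu, X >-> borel K}])%qT by rewrite reprK.
  by rewrite eqmodE => /asboolP; apply: filterS => x /(_ I).
have [|u [uq _]] := @bfs_lattice _ _ _ _ _ E q v.
  by apply: filterS2 qg gv => x ->.
by exists u; rewrite /fun_of uq.
Qed.

(** By (H1), [M] times the indicator of [A] dominates [g]. *)
Lemma exists_bounded_fun_of (g : X -> K) A (M : K) : contains_indicators E ->
  measurable A -> (mu A < +oo)%E -> measurable_fun setT (g : X -> borel K) ->
  (forall x, `|g x| <= M) -> (forall x, ~ A x -> g x = 0) ->
  exists u, \forall x \ae mu, fun_of u x = g x.
Proof.
move=> H1 mA Aoo mg gM gA; have [v vA] := H1 A mA Aoo.
apply: (@exists_fun_of _ (M *: v)) => //.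
apply: filterS2 (fun_ofZ M v) vA => x -> /(_ I) ->.
rewrite indicE; have [xA|nxA] := pselect (A x).
  rewrite mem_set// mulr1 (le_trans (gM x))// real_ler_norm// ger0_real//.
  exact: le_trans (gM x).
by rewrite gA// normr0.
Qed.

Lemma fun_of_iter (f : X -> X) (T : E -> E) k u :
  measurable_fun setT f -> nonsingular mu f -> is_composition_operator f T ->
  \forall x \ae mu, fun_of (iter k T u) x = fun_of u (iter k f x).
Proof.
move=> mf nsf Tf; elim: k => [|k IHk]; first exact: aeW.
apply: filterS2 (Tf (iter k T u)) (ae_comp mf nsf IHk) => x /(_ I) /= -> ->.
by rewrite -iterSr.
Qed.

End FunctionSpace.

(** * Mixing versus conditions on sets *)

Section Mixing.
Context (R : realType) (d : measure_display) (X : measurableType d)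
  (mu : {measure set X -> \bar R}) (K : numFieldType)
  (E : banach_function_space mu K).
Implicit Types (u v : E) (A B S : set X).

Lemma norm_ge1_or_dist2_ge1 (z : K) : 1 <= `|z| \/ 1 <= `|z - 2|.
Proof.
have [|z1] := real_leP (@real1 K) (normr_real z); [by left|right].
rewrite distrC (le_trans _ (lerB_dist _ _))// normr_nat lerBrDr.
by rewrite -[2]/(1 + 1) lerD2l ltW.
Qed.

(** Membership in [S] is compared only a.e., so that [S] can be a preimage under [f] or its
    iterates: [T w] equals [w] composed with [f] only a.e. *)
Definition approximates_indicator (eps : R) A (a : E) (delta : K) :=
  (forall w : E, `|w - a| <= delta ->
    forall S, measurable S -> (\forall x \ae mu, S x <-> 1 <= `|fun_of w x|) ->
    (mu (A `+` S) < eps%:E)%E) /\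
  (forall w : E, `|w| <= delta ->
    forall S, measurable S -> (\forall x \ae mu, S x -> 1 <= `|fun_of w x|) ->
    (mu S < eps%:E)%E).

(* The centre is twice the indicator: a value [z] then satisfies [1 <= `|z|]
   unless it is at distance at least 1 from 2, so (H3) applies unscaled. *)
Lemma exists_indicator_ball (eps : R) A : contains_indicators E ->
  small_norm_small_support E -> 0 < eps -> measurable A -> (mu A < +oo)%E ->
  exists a delta, 0 < delta /\ approximates_indicator eps A a delta.
Proof.
move=> H1 H3 e0 mA Aoo; have [v vA] := H1 A mA Aoo.
have [delta [delta0 Hd]] := H3 _ e0.
have eps2 : eps / 2 <= eps by rewrite ler_pdivrMr// mulr_natr mulr2n lerDl ltW.
exists (2 *: v), delta; split=> //; split=> [w wa S mS Sw|w wd S mS Sw]; last first.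
  by apply: lt_le_trans (Hd _ _ mS Sw wd) _; rewrite lee_fin.
have wA : \forall x \ae mu,
    fun_of (w - 2 *: v) x = fun_of w x - 2 * \1_A x.
  by apply: filterS3 (fun_ofB w (2 *: v)) (fun_ofZ 2 v) vA => x -> -> /(_ I) ->.
(* (H3) yields [eps / 2] for each side of the symmetric difference; outside [A], [w - 2 *: v] is [w]
   itself. *)
rewrite [eps](splitr eps) EFinD.
apply: le_lt_trans (measureU2 _ _ _) _ => //; try exact: measurableD.
apply: lteD; apply: (Hd _ _ _ _ wa); try exact: measurableD.
  apply: filterS2 wA Sw => x -> Sw [Ax nSx].
  rewrite indicE mem_set// mulr1.
  by have [/Sw//|//] := norm_ge1_or_dist2_ge1 (fun_of w x).
apply: filterS2 wA Sw => x -> Sw [Sx nAx].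
by rewrite indicE memNset// mulr0 subr0; exact/Sw.
Qed.

Section CompositionOperator.
Variables (f : X -> X) (T : {linear E -> E}).
Hypotheses (mf : measurable_fun setT f) (nsf : nonsingular mu f)
  (Tf : is_composition_operator f T).

Lemma iter_linearD k u v : iter k T (u + v) = iter k T u + iter k T v.
Proof. by elim: k => //= k ->; rewrite linearD. Qed.

Lemma mixing_ae_preimage A : admissible E -> topologically_mixing T ->
  measurable A -> (mu A < +oo)%E -> ae_preimage mu f A.
Proof.
move=> [H1 _ H3 _] Tmix mA Aoo; apply: ae_preimage_approx => // eps e0.
have [a [delta [delta0 [aA _]]]] := exists_indicator_ball H1 H3 e0 mA Aoo.
(* Starting from the whole space gives density of the range; the successor exponent leaves an
   outermost [T], so the point found is [T w]. *)
have [||||k0 /(_ k0.+1)] := Tmix setT (ball a delta).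
- exact: openT.
- exact: ball_open.
- by exists 0.
- by exists a; exact: ballxx.
move=> /(_ (leqnSn _))[_ [[u _ <-]]]; rewrite -ball_normE /= distrC => /ltW wa.
set w := iter k0 T u in wa.
exists [set x | 1 <= `|fun_of w x|].
  exact: measurable_norm_ge1 (measurable_fun_of w).
apply: aA wa _ _ _.
  apply: measurable_preimage => //.
  exact: measurable_norm_ge1 (measurable_fun_of w).
by apply: filterS (Tf w) => x /(_ I) ->.
Qed.

Lemma mixing_hyperbolic A (eps : R) : admissible E -> topologically_mixing T ->
  0 < eps -> measurable A -> (mu A < +oo)%E ->
  exists k0, forall k, (k0 <= k)%N -> exists B C,
    [/\ measurable B, measurable C &
     [/\ (mu (A `\` B) < eps%:E)%E, (mu (iter k f @^-1` B) < eps%:E)%E,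
         iter k f @` B `<=` C & (mu C < eps%:E)%E]].
Proof.
move=> [H1 _ H3 _] Tmix e0 mA Aoo.
have e20 : 0 < eps / 2 by rewrite divr_gt0.
have eps2 : eps / 2 <= eps by rewrite ler_pdivrMr// mulr_natr mulr2n lerDl ltW.
have [a [delta [delta0 [aA a0]]]] := exists_indicator_ball H1 H3 e20 mA Aoo.
have o0 : open (ball (0 : E) delta) by exact: ball_open.
have oa : open (ball a delta) by exact: ball_open.
have n0 : ball (0 : E) delta !=set0 by exists 0; exact: ballxx.
have na : ball a delta !=set0 by exists a; exact: ballxx.
(* First [u] near [a] with image near 0, then [v] near 0 with image near [a]. *)
have [k1 Hk1] := Tmix _ _ oa o0 na n0.
have [k2 Hk2] := Tmix _ _ o0 oa n0 na.
exists (maxn k1 k2) => k; rewrite geq_max => /andP[/Hk1 + /Hk2].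
move=> [_ [[u + <-]]]; rewrite -ball_normE /= distrC sub0r normrN.
move=> /ltW ua /ltW Tu0 [_ [[v + <-]]].
rewrite /ball_ /= sub0r normrN distrC => /ltW v0 /ltW Tva.
pose B1 := [set x | 1 <= `|fun_of u x|].
pose C := [set x | 1 <= `|fun_of v x|].
have mB1 : measurable B1 by exact: measurable_norm_ge1 (measurable_fun_of u).
have mC : measurable C by exact: measurable_norm_ge1 (measurable_fun_of v).
have mfk := measurable_iter k mf.
have mfkC := measurable_preimage mfk mC.
have mB : measurable (B1 `&` iter k f @^-1` C) by exact: measurableI.
have lt_eps S : (mu S < (eps / 2)%:E)%E -> (mu S < eps%:E)%E.
  by move=> /lt_le_trans; apply; rewrite lee_fin.
have AB1 : (mu (A `+` B1) < (eps / 2)%:E)%E.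
  by apply: aA ua _ mB1 _; exact: aeW.
have AC : (mu (A `+` iter k f @^-1` C) < (eps / 2)%:E)%E.
  apply: aA Tva _ mfkC _.
  by apply: filterS (fun_of_iter k v mf nsf Tf) => x ->.
exists (B1 `&` iter k f @^-1` C), C; split=> //; split.
(* Removing an intersection from [A] leaves two pieces, one bounded through [u], the other through
   [iter k T v]. *)
- rewrite setDIr [eps](splitr eps) EFinD.
  apply: le_lt_trans (measureU2 _ _ _) _; try exact: measurableD.
  apply: lteD; [apply: le_lt_trans AB1|apply: le_lt_trans AC];
    (rewrite le_measure ?inE//; [exact: measurableD|exact: measurable_setY|
     exact: subsetUl]).
(* On this preimage [iter k T u] has norm at least 1, yet it is close to 0. *)
- apply/lt_eps/(a0 _ Tu0); first exact: measurable_preimage.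
  by apply: filterS (fun_of_iter k u mf nsf Tf) => x -> [].
- by move=> _ [x [_ Cx] <-].
- by apply/lt_eps/(a0 _ v0) => //; exact: aeW.
Qed.

Lemma hyperbolic_mixing : admissible E ->
  (forall A, measurable A -> ae_preimage mu f A) ->
  (forall (eps : R) A, 0 < eps -> measurable A -> (mu A < +oo)%E ->
   exists k0, forall k, (k0 <= k)%N -> exists B C,
    [/\ measurable B, measurable C &
     [/\ (mu (A `\` B) < eps%:E)%E, (mu (iter k f @^-1` B) < eps%:E)%E,
         iter k f @` B `<=` C & (mu C < eps%:E)%E]]) ->
  topologically_mixing T.
Proof.
move=> [H1 H2 _ H4] fB hyp U V oU oV U0 V0.
have [u [Uu [s [[ms fs [A1 [mA1 A1oo sA1]]] us]]]] := H2 U U0 oU.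
have [v [Vv [t [[mt ft [A2 [mA2 A2oo tA2]]] vt]]]] := H2 V V0 oV.
have /nbhs_ballP[r1 /= r10 Ur] : nbhs u U by exact: open_nbhs_nbhs.
have /nbhs_ballP[r2 /= r20 Vr] : nbhs v V by exact: open_nbhs_nbhs.
have [M1 M10 sM1] := finite_range_bounded fs.
have [M2 M20 tM2] := finite_range_bounded ft.
(* One bound for both [s] and [t], hence also for [g]. *)
pose M := M1 + M2.
have M0 : 0 < M by exact: addr_gt0.
have sM x : `|s x| <= M by rewrite (le_trans (sM1 x))// lerDl ltW.
have tM x : `|t x| <= M by rewrite (le_trans (tM2 x))// lerDr ltW.
have M2M : M <= 2 * M by rewrite mulr_natl mulr2n lerDl ltW.
have [e1 [e10 small1]] := H4 _ _ r10 M0.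
have [e2 [e20 small2]] := H4 _ _ r20 M0.
pose e := Num.min e1 e2.
have e0 : 0 < e by rewrite lt_min e10.
have ee1 : (e%:E <= e1%:E)%E by rewrite lee_fin ge_min lexx.
have ee2 : (e%:E <= e2%:E)%E by rewrite lee_fin ge_min lexx orbT.
(* The same [B] must nearly cover the supports of both [s] and [t]. *)
have mA := measurableU _ _ mA1 mA2.
have Aoo : (mu (A1 `|` A2) < +oo)%E.
  by apply: le_lt_trans (measureU2 _ mA1 mA2) _; exact: lte_add_pinfty.
have [k0 Hk] := hyp e _ e0 mA Aoo.
exists k0 => k /Hk[B [C [mB mC [AB fkB fBC Ce]]]].
have mfk := measurable_iter k mf.
have [g [mg gM tg]] := finite_range_factor
  (fun A => @ae_preimage_iter _ _ _ mu f k A mf nsf fB) (ltW M0) mt ft tM.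
have [p ps] : exists p, \forall x \ae mu,
    fun_of (p : E) x = if x \in B then s x else 0.
  apply: (@exists_bounded_fun_of _ _ _ _ _ E _ _ M H1 mA1 A1oo).
  - by apply: measurable_glue => //; exact: measurable_cst.
  - by move=> x; case: ifP => // _; rewrite normr0 ltW.
  - by move=> x /sA1 ->; case: ifP.
(* Cutting [g] to [C] makes [q] small, although [g] itself may have large support. *)
have [q qg] : exists q, \forall x \ae mu,
    fun_of (q : E) x = if x \in C then g x else 0.
  apply: (@exists_bounded_fun_of _ _ _ _ _ E _ _ M H1 mC).
  - exact: lt_trans Ce (ltry _).
  - by apply: measurable_glue => //; exact: measurable_cst.
  - by move=> x; case: ifP => // _; rewrite normr0 ltW.
  - by move=> x nC; rewrite memNset.
have mAB : measurable ((A1 `|` A2) `\` B) by exact: measurableD.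
have up : `|u - p| < r1 / 2.
  have uE : \forall x \ae mu,
      fun_of (u - p) x = if x \in B then 0 else s x.
    apply: filterS3 (fun_ofB u p) us ps => x -> /(_ I) -> ->.
    by case: ifP; rewrite ?subrr ?subr0.
  apply: (small1 _ _ mAB (lt_le_trans AB ee1)).
  - apply: filterS uE => x -> nABx; case: ifPn => //; rewrite notin_setE => nB.
    by apply: sA1 => A1x; apply: nABx; split=> //; left.
  - apply: filterS uE => x ->; apply: le_trans M2M.
    by case: ifP => // _; rewrite normr0 ltW.
have q0 : `|q| < r1 / 2.
  apply: (small1 _ _ mC (lt_le_trans Ce ee1)).
  - by apply: filterS qg => x -> nC; rewrite memNset.
  - apply: filterS qg => x ->; apply: le_trans M2M.
    by case: ifP => // _; rewrite normr0 ltW.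
have Tp0 : `|iter k T p| < r2 / 2.
  have TpE : \forall x \ae mu,
      fun_of (iter k T p) x = if iter k f x \in B then s (iter k f x) else 0.
    apply: filterS2 (fun_of_iter k p mf nsf Tf)
      (ae_comp mfk (nonsingular_iter k mf nsf) ps) => x -> ->.
    by [].
  apply: (small2 _ _ (measurable_preimage mfk mB) (lt_le_trans fkB ee2)).
  - by apply: filterS TpE => x -> nB; rewrite memNset.
  - apply: filterS TpE => x ->; apply: le_trans M2M.
    by case: ifP => // _; rewrite normr0 ltW.
have vTq : `|v - iter k T q| < r2 / 2.
  have Tq : \forall x \ae mu,
      fun_of (iter k T q) x = if iter k f x \in C then t x else 0.
    apply: filterS3 (fun_of_iter k q mf nsf Tf)
      (ae_comp mfk (nonsingular_iter k mf nsf) qg) tg => x -> ->.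
    by move=> ->.
  have vE : \forall x \ae mu,
      fun_of (v - iter k T q) x = if iter k f x \in C then 0 else t x.
    apply: filterS3 (fun_ofB v (iter k T q)) vt Tq => x -> /(_ I) -> ->.
    by case: ifP; rewrite ?subrr ?subr0.
  (* The difference vanishes off [A2], where [t] is zero, and on [B], which [iter k f] sends into
     [C]. *)
  apply: (small2 _ _ mAB (lt_le_trans AB ee2)).
  - apply: filterS vE => x -> nABx; case: ifPn => //; rewrite notin_setE => nC.
    apply: tA2 => A2x; apply: nABx; split; [by right|move=> Bx].
    by apply/nC/fBC; exists x.
  - apply: filterS vE => x ->; apply: le_trans M2M.
    by case: ifP => // _; rewrite normr0 ltW.
exists (iter k T (p + q)); split.
  exists (p + q) => //; apply: Ur; rewrite -ball_normE /= opprD addrA.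
  by rewrite [r1](splitr r1); apply: le_lt_trans (ler_normB _ _) (ltrD up q0).
apply: Vr; rewrite -ball_normE /= iter_linearD opprD addrA addrAC.
by rewrite [r2](splitr r2); apply: le_lt_trans (ler_normB _ _) (ltrD vTq Tp0).
Qed.

End CompositionOperator.
End Mixing.

(** * Assembly of the equivalence *)

Unset Implicit Arguments.

Theorem theorem1p2 (R : realType) (s : scalar_kind) (d : measure_display)
    (X : measurableType d) (mu : {measure set X -> \bar R})
    (mu_sigma_finite : sigma_finite [set: X] mu)
    (mu_pos : (0 < mu [set: X])%E)
    (E : banach_function_space mu (scalars R s))
    (E_admissible : admissible E)
    (f : X -> X)
    (f_measurable : measurable_fun [set: X] f)
    (f_nonsingular : nonsingular mu f)
    (T : {linear E -> E})
    (T_composition : is_composition_operator f T)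
    (T_bounded : bounded_operator T) :
  topologically_mixing T
  <->
  (eq_mod_null mu [set f @^-1` S | S in measurable] measurable /\
   forall eps : R, 0 < eps ->
   forall A : set X, measurable A -> (mu A < +oo)%E ->
   exists (k0 : nat) (B C : nat -> set X),
     (1 <= k0)%N /\
     (forall k : nat, measurable (B k) /\ measurable (C k)) /\
     forall k : nat, (k0 <= k)%N ->
       [/\ (mu (A `\` B k) < eps%:E)%E,
           (mu (iter k f @^-1` B k) < eps%:E)%E,
           iter k f @` B k `<=` C k &
           (mu (C k) < eps%:E)%E]).
Proof.
split=> [Tmix|[fB hyp]]; last first.
  apply: (hyperbolic_mixing f_measurable f_nonsingular T_composition) => //.
    move=> A mA; have [_ [[S mS <-] AS]] := fB.2 A mA.
    have mfS := measurable_preimage f_measurable mS.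
    by exists S => //; apply/(measure_setY0 _ mA mfS); rewrite setYC.
  move=> eps A e0 mA Aoo; have [k0 [B [C [_ [mBC BC]]]]] := hyp eps e0 A mA Aoo.
  by exists k0 => k kk; have [mB mC] := mBC k; exists (B k), (C k);
    split=> //; exact: BC.
have mixB := mixing_ae_preimage f_measurable T_composition E_admissible Tmix.
split.
  split=> [A [S mS <-]|A mA].
    by exists (f @^-1` S); split; [exact: measurable_preimage|rewrite setYK].
  have [S mS AS] := ae_preimage_sigma_finite mu_sigma_finite mixB mA.
  exists (f @^-1` S); split; first by exists S.
  have mfS := measurable_preimage f_measurable mS.
  by rewrite setYC; apply/measure_setY0.
move=> eps e0 A mA Aoo.
have [k0 Hk] := mixing_hyperbolic f_measurable f_nonsingular T_composition
  E_admissible Tmix e0 mA Aoo.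
have {}Hk k : exists BC : set X * set X, measurable BC.1 /\ measurable BC.2 /\
    ((k0 <= k)%N -> [/\ (mu (A `\` BC.1) < eps%:E)%E,
      (mu (iter k f @^-1` BC.1) < eps%:E)%E,
      iter k f @` BC.1 `<=` BC.2 & (mu BC.2 < eps%:E)%E]).
  have [/Hk[B [C [mB mC BC]]]|kk0] := leqP k0 k; first by exists (B, C).
  (* Below [k0] nothing but measurability is required, so empty sets fill the sequences. *)
  exists (set0, set0).
  by split; [exact: measurable0|split=> //; exact: measurable0].
have [BC HBC] := choice Hk.
(* The successor ensures a threshold of at least 1. *)
exists k0.+1, (fun k => (BC k).1), (fun k => (BC k).2); split=> //; split.
  by move=> k; have [? [? _]] := HBC k.
by move=> k /ltnW k0k; have [_ [_ /(_ k0k)]] := HBC k.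
Qed.
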